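(* Let $k$ be a field and let $A$ be a finite dimensional quasitriangular Hopf algebra over $k$ such that the even cohomology algebra $\mathrm{H}^{\mathrm{ev}}(A,k)$ is finitely generated and $\mathrm{Ext}^{\bullet}_A(M,N)$ is a finitely generated $\mathrm{H}^{\mathrm{ev}}(A,k)$-module for all finitely generated left $A$-modules $M$ and $N$. Then for all finitely generated left $A$-modules $M$ and $N$, $$\mathcal{V}_A(M\otimes N)\subseteq \mathcal{V}_A(M)\cap \mathcal{V}_A(N).$$
   Context: For a finite dimensional Hopf algebra $A$ over $k$, $\mathrm{H}^{*}(A,k):=\mathrm{Ext}^{*}_A(k,k)$ is an associative graded commutative $k$-algebra under the cup product (equivalently, Yoneda composition), where $k$ is the trivial module given by the counit; $\mathrm{H}^{\mathrm{ev}}(A,k)=\bigoplus_{n\ge 0}\mathrm{H}^{2n}(A,k)$ is the commutative subalgebra of even-degree elements. Tensor products of modules are over $k$, with $A$ acting via the comultiplication. For finitely generated left $A$-modules $M,N$, the algebra $\mathrm{H}^{*}(A,k)$ acts on $\mathrm{Ext}^{\bullet}_A(M,N)=\bigoplus_{n\ge0}\mathrm{Ext}^n_A(M,N)$ by applying $-\otimes N$ (giving a map $\mathrm{H}^{*}(A,k)\to \mathrm{Ext}^{*}_A(N,N)$) followed by Yoneda composition. For a finitely generated left $A$-module $M$, let $I_A(M)$ be the annihilator in $\mathrm{H}^{\mathrm{ev}}(A,k)$ of $\mathrm{Ext}^{\bullet}_A(M,M)$ under this action. The support variety $\mathcal{V}_A(M)$ is the maximal ideal spectrum of the finitely generated commutative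 $k$-algebra $\mathrm{H}^{\mathrm{ev}}(A,k)/I_A(M)$, identified with the closed subset of the maximal ideal spectrum of $\mathrm{H}^{\mathrm{ev}}(A,k)$ consisting of the maximal ideals containing $I_A(M)$. Inclusions and intersections of support varieties are taken inside the maximal ideal spectrum of $\mathrm{H}^{\mathrm{ev}}(A,k)$. *)

(* Defs.v *)
From HB Require Import structures.
From mathcomp Require Import all_boot all_order all_algebra all_field.
From mathcomp Require Import generic_quotient ring_quotient.
From mathcomp Require Import boolp classical_sets.

Set Implicit Arguments.
Unset Strict Implicit.
Unset Printing Implicit Defensive.

Import GRing.Theory VectorInternalTheory.

Local Open Scope ring_scope.
Local Open Scope classical_set_scope.

Section LinearFacts.
Variables (k : fieldType) (U V : vectType k) (f : U -> V).
Hypothesis lf : linear f.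

Lemma lin0 : f 0 = 0.
Proof. by have := lf (-1) 0 0; rewrite scaler0 addr0 scaleN1r addNr. Qed.

Lemma linD x y : f (x + y) = f x + f y.
Proof. by have := lf 1 x y; rewrite !scale1r. Qed.

Lemma linZ c x : f (c *: x) = c *: f x.
Proof. by have := lf c x 0; rewrite lin0 !addr0. Qed.

Lemma linsum (I : finType) (g : I -> U) : f (\sum_i g i) = \sum_i f (g i).
Proof. by apply: (big_morph f linD lin0). Qed.

Lemma linfunP x : linfun f x = f x.
Proof.
have E : f =1 linfun f.
  pose F : {linear U -> V} := HB.pack f (GRing.isLinear.Build k U V _ f lf).
  by move=> y; rewrite -[RHS]/(linfun F y) lfunE.
by rewrite -E.
Qed.

End LinearFacts.

(* U (x) V over k is realized as a matrix space, using the coordinates that *)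
(* come with the vectType structures of U and V: u \ot v has entries u_i v_j. *)

Definition tens (k : fieldType) (U V : vectType k) : vectType k :=
  'M[k]_(dim U, dim V).

Definition tensv (k : fieldType) (U V : vectType k) (u : U) (v : V) :
  tens U V := (v2r u)^T *m v2r v.

Notation "u \ot v" := (tensv u v) (at level 40, left associativity).

Definition bas (k : fieldType) (U : vectType k) (i : 'I_(dim U)) : U :=
  r2v (delta_mx 0 i).

(* The linear map induced on tens U V by a bilinear map b. *)
Definition tlift (k : fieldType) (U V W : vectType k) (b : U -> V -> W)
    (t : tens U V) : W :=
  \sum_i \sum_j (t : 'M_(_, _)) i j *: b (bas i) (bas j).

Definition bilin (k : fieldType) (U V W : vectType k) (b : U -> V -> W) :=
  (forall v, linear (b^~ v)) /\ (forall u, linear (b u)).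

Lemma bas_sum (k : fieldType) (U : vectType k) (u : U) : u = \sum_i v2r u 0 i *: bas i.
Proof.
rewrite -[LHS]v2rK [in LHS](row_sum_delta (v2r u)) linear_sum.
by apply: eq_bigr => i _; rewrite linearZ.
Qed.

Section TensorFacts.
Variables (k : fieldType) (U V W : vectType k).

Lemma tensv_bilin : bilin (@tensv k U V).
Proof.
by split=> [v c u u'|u c v v']; rewrite /tensv !linearP /= ?mulmxDl -?scalemxAl.
Qed.

Lemma tlift_linear (b : U -> V -> W) : linear (tlift b).
Proof.
move=> c s t; rewrite /tlift scaler_sumr -big_split; apply: eq_bigr => i _.
rewrite scaler_sumr -big_split; apply: eq_bigr => j _ /=.
by rewrite !mxE scalerDl scalerA.
Qed.

Lemma tlift_pure (b : U -> V -> W) u v : bilin b -> tlift b (u \ot v) = b u v.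
Proof.
case=> bl br; rewrite [in RHS](bas_sum u) (linsum (bl v)) /tlift.
apply: eq_bigr => i _; rewrite [in RHS](bas_sum v) (linZ (bl _)).
rewrite (linsum (br _)) scaler_sumr; apply: eq_bigr => j _.
by rewrite (linZ (br _)) scalerA /tensv mxE big_ord1 mxE.
Qed.

Lemma tens_sum (t : tens U V) :
  t = \sum_i \sum_j (t : 'M_(_, _)) i j *: (bas i \ot bas j).
Proof.
apply/matrixP => i j; rewrite summxE (bigD1 i) //= summxE (bigD1 j) //=.
have E i' j' :
    ((bas i' \ot bas j' : tens U V) : 'M_(_, _)) i j = (i == i')%:R * (j == j')%:R.
  rewrite /tensv mxE big_ord1 !mxE /bas !r2vK !mxE eqxx /=.
  by rewrite [_ == i']eq_sym [_ == j']eq_sym ![i' == _]eq_sym ![j' == _]eq_sym.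
rewrite mxE E !eqxx !mulr1 !big1 ?addr0 //.
  move=> i' ne; rewrite summxE big1 // => j' _.
  by rewrite mxE E [i == i']eq_sym (negPf ne) mul0r mulr0.
by move=> j' ne; rewrite mxE E [j == j']eq_sym (negPf ne) !mulr0.
Qed.

Lemma tens_eq (f g : tens U V -> W) : linear f -> linear g ->
  (forall u v, f (u \ot v) = g (u \ot v)) -> f =1 g.
Proof.
move=> lf lg E t; rewrite (tens_sum t) (linsum lf) (linsum lg).
apply: eq_bigr => i _; rewrite (linsum lf) (linsum lg).
by apply: eq_bigr => j _; rewrite (linZ lf) (linZ lg) E.
Qed.

Lemma eq_tlift (b c : U -> V -> W) : b =2 c -> tlift b =1 tlift c.
Proof.
by move=> E t; apply: eq_bigr => i _; apply: eq_bigr => j _; rewrite E.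
Qed.

Lemma tlift_lin_param (X : vectType k) (b : X -> U -> V -> W) t :
  (forall u v, linear (fun x => b x u v)) -> linear (fun x => tlift (b x) t).
Proof.
move=> lb c x y; rewrite /tlift scaler_sumr -big_split; apply: eq_bigr => i _.
rewrite scaler_sumr -big_split; apply: eq_bigr => j _ /=.
by rewrite lb scalerDr !scalerA mulrC.
Qed.

End TensorFacts.

Definition tmap (k : fieldType) (U U' V V' : vectType k)
    (f : U -> U') (g : V -> V') : tens U V -> tens U' V' :=
  tlift (fun u v => f u \ot g v).

Lemma tmap_bilin (k : fieldType) (U U' V V' : vectType k)
    (f : U -> U') (g : V -> V') :
  linear f -> linear g -> bilin (fun u v => f u \ot g v).
Proof.
by case: (@tensv_bilin k U' V') => bl br lf lg; split=> [v c x y|u c x y] /=;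
  rewrite ?lf ?lg ?bl ?br.
Qed.

Lemma tmap_pure (k : fieldType) (U U' V V' : vectType k)
    (f : U -> U') (g : V -> V') u v :
  linear f -> linear g -> tmap f g (u \ot v) = f u \ot g v.
Proof. by move=> lf lg; rewrite /tmap tlift_pure //; exact: tmap_bilin. Qed.

Definition tassoc (k : fieldType) (U V W : vectType k) :
    tens (tens U V) W -> tens U (tens V W) :=
  tlift (fun t w => tlift (fun u v => u \ot (v \ot w)) t).

Definition tflip (k : fieldType) (U V : vectType k) : tens U V -> tens V U :=
  tlift (fun u v => v \ot u).

(* (a \ot b) (c \ot d) = m a c \ot n b d *)
Definition tmulg (k : fieldType) (U V : vectType k)
    (m : U -> U -> U) (n : V -> V -> V) (s t : tens U V) : tens U V :=
  tlift (fun a b => tlift (fun c d => m a c \ot n b d) t) s.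

Definition tmul (k : fieldType) (A : falgType k) :
    tens A A -> tens A A -> tens A A :=
  tmulg (fun a b : A => a * b) (fun a b : A => a * b).

Record hopfAlg (k : fieldType) := HopfAlg {
  hopf_alg :> falgType k;
  comul : 'Hom(hopf_alg, tens hopf_alg hopf_alg);
  counit : 'Hom(hopf_alg, k^o);
  antipode : 'End(hopf_alg);
  comul1 : comul 1 = 1 \ot 1;
  comulM : forall a b, comul (a * b) = tmul (comul a) (comul b);
  counit1 : counit 1 = 1;
  counitM : forall a b, counit (a * b) = counit a * counit b;
  coassoc : forall a,
    tassoc (tmap comul id (comul a)) = tmap id comul (comul a);
  counitl : forall a, tlift (fun x y => counit x *: y) (comul a) = a;
  counitr : forall a, tlift (fun x y => counit y *: x) (comul a) = a;
  antipodel : forall a,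
    tlift (fun x y => antipode x * y) (comul a) = counit a *: 1;
  antipoder : forall a,
    tlift (fun x y => x * antipode y) (comul a) = counit a *: 1
}.

Definition tmul3 (k : fieldType) (A : falgType k) :
    tens (tens A A) A -> tens (tens A A) A -> tens (tens A A) A :=
  tmulg (@tmul k A) (fun a b : A => a * b).

Section RMatrix.
Variables (k : fieldType) (A : hopfAlg k) (R : tens A A).

Definition R12 : tens (tens A A) A :=
  tlift (fun a b : A => (a \ot b : tens A A) \ot (1 : A)) R.
Definition R13 : tens (tens A A) A :=
  tlift (fun a b : A => (a \ot (1 : A) : tens A A) \ot b) R.
Definition R23 : tens (tens A A) A :=
  tlift (fun a b : A => ((1 : A) \ot a : tens A A) \ot b) R.

(* R is a universal R-matrix, i.e. (A, R) is a quasitriangular Hopf algebra. *)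
Definition universalR : Prop :=
  [/\ exists Rinv : tens A A,
        tmul R Rinv = 1 \ot 1 /\ tmul Rinv R = 1 \ot 1,
      forall a, tmul (tflip (comul A a)) R = tmul R (comul A a),
      tmap (comul A) id R = tmul3 R13 R23 &
      tmap id (comul A) R = tassoc (tmul3 R13 R12)].

End RMatrix.

Definition quasitriangular (k : fieldType) (A : hopfAlg k) : Prop :=
  exists R : tens A A, universalR R.

(* Finitely generated left A-modules. As A is finite dimensional over k,    *)
(* these are the left A-modules that are finite dimensional over k.         *)

Record amod (k : fieldType) (A : falgType k) := AMod {
  amod_sort :> vectType k;
  act : A -> amod_sort -> amod_sort;
  act_bilin : bilin act;
  act1 : forall x, act 1 x = x;
  actM : forall a b x, act (a * b) x = act a (act b x)
}.

Section Modules.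
Variables (k : fieldType) (A : falgType k).
Implicit Types M N : amod A.

(* The subspace Hom_A(M, N) of 'Hom(M, N). *)
Definition homA M N : {vspace 'Hom(M, N)} :=
  (\bigcap_(i < dim A) lker (linfun (fun f : 'Hom(M, N) =>
     ((f \o linfun (act (bas i))) - (linfun (act (bas i)) \o f))%VF)))%VS.

Lemma homAP M N (f : 'Hom(M, N)) :
  reflect (forall a x, f (act a x) = act a (f x)) (f \in homA M N).
Proof.
have [[Ml Mr] [Nl Nr]] := (act_bilin M, act_bilin N).
have E i (g : 'Hom(M, N)) : linfun (fun f : 'Hom(M, N) =>
     ((f \o linfun (act (bas i))) - (linfun (act (bas i)) \o f))%VF) g =
    ((g \o linfun (act (bas i))) - (linfun (act (bas i)) \o g))%VF.
  rewrite linfunP // => c g1 g2 /=.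
  rewrite comp_lfunDl comp_lfunDr -comp_lfunZl -comp_lfunZr.
  by rewrite opprD scalerBr addrACA.
apply: (iffP idP) => [fA a x|fA].
  rewrite (bas_sum a) (linsum (Ml x)) (linsum (Nl (f x))) linear_sum.
  apply: eq_bigr => i _; rewrite (linZ (Ml x)) (linZ (Nl (f x))) linearZ /=.
  congr (_ *: _); have /subv_bigcapP/(_ i isT) : (<[f]> <= homA M N)%VS by [].
  rewrite -memvE memv_ker E subr_eq0 => /eqP/lfunP/(_ x).
  by rewrite !comp_lfunE (linfunP (Mr _)) (linfunP (Nr _)).
rewrite memvE; apply/subv_bigcapP => i _; rewrite -memvE memv_ker E subr_eq0.
apply/eqP/lfunP => x.
by rewrite !comp_lfunE (linfunP (Mr _)) (linfunP (Nr _)) fA.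
Qed.

(* Projectivity in the category of finitely generated modules. *)
Definition projective (P : amod A) : Prop :=
  forall (X Y : amod A) (g : 'Hom(X, Y)) (f : 'Hom(P, Y)),
    g \in homA X Y -> limg g = fullv -> f \in homA P Y ->
    exists2 h : 'Hom(P, X), h \in homA P X & (g \o h)%VF = f.

Record projres M := ProjRes {
  res :> nat -> amod A;
  res_d : forall n, 'Hom(res n.+1, res n);
  res_aug : 'Hom(res 0, M);
  res_proj : forall n, projective (res n);
  res_dA : forall n, res_d n \in homA (res n.+1) (res n);
  res_augA : res_aug \in homA (res 0) M;
  res_exact : forall n, limg (res_d n.+1) = lker (res_d n);
  res_exact0 : limg (res_d 0) = lker res_aug;
  res_onto : limg res_aug = fullv
}.

Section Free.
Variable V : vectType k.

Definition free_act (a : A) : tens A V -> tens A V :=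
  tmap (fun b : A => a * b) (id : V -> V).

Let lmull (a : A) : linear (fun b : A => a * b).
Proof. by move=> c x y; rewrite mulrDr scalerAr. Qed.

Let lid : linear (id : V -> V). Proof. by []. Qed.

Lemma free_act_bilin : bilin free_act.
Proof.
split=> [t|a]; last exact: tlift_linear.
apply: (@tlift_lin_param _ _ _ _ A (fun a b v => (a * b) \ot v)) => b v c x y.
by rewrite mulrDl -scalerAl; case: (tensv_bilin A V) => ->.
Qed.

Lemma free_act1 t : free_act 1 t = t.
Proof.
apply: (tens_eq (f := free_act 1) (g := id)) => //; first exact: tlift_linear.
by move=> a v; rewrite /free_act tmap_pure // mul1r.
Qed.

Lemma free_actM a b t : free_act (a * b) t = free_act a (free_act b t).
Proof.
apply: (tens_eq (f := free_act (a * b))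
                (g := fun t => free_act a (free_act b t))).
- exact: tlift_linear.
- by move=> c x y; rewrite !(free_act_bilin.2 _).
- by move=> x v; rewrite /free_act !tmap_pure // mulrA.
Qed.

Definition freemod := AMod free_act_bilin free_act1 free_actM.

Lemma freemod_proj : projective freemod.
Proof.
move=> X Y g f /homAP gA g_onto /homAP fA.
have [Xl Xr] := act_bilin X.
pose s v : X := (g^-1 \o f)%VF ((1 : A) \ot v : tens A V).
have tr := (tensv_bilin A V).2.
have sb : bilin (fun (a : A) (v : V) => act a (s v)).
  by split=> [v|a c u v]; [exact: Xl | rewrite /s tr linearP Xr].
have h_lin : linear (tlift (fun (a : A) (v : V) => act a (s v))).
  exact: tlift_linear.
exists (linfun (tlift (fun (a : A) (v : V) => act a (s v)) :
          freemod -> X)).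
  apply/homAP => a x; rewrite !(linfunP h_lin).
  apply: (tens_eq (f := fun t => tlift _ (free_act a t))
                  (g := fun t => act a (tlift _ t))) => [c t u|c t u|b v].
  - by rewrite (free_act_bilin.2 _) h_lin.
  - by rewrite h_lin Xr.
  - by rewrite /free_act tmap_pure // !tlift_pure // actM.
apply/lfunP => x; rewrite comp_lfunE (linfunP h_lin).
apply: (tens_eq (f := fun t => g (tlift _ t)) (g := fun t => f t))
    => [c t u|c t u|a v].
- by rewrite h_lin linearP.
- by rewrite linearP.
rewrite tlift_pure // gA /s comp_lfunE limg_lfunVK ?g_onto ?memvf // -fA /=.
by rewrite /free_act tmap_pure // mulr1.
Qed.

End Free.

(* A (x) M -> M, a \ot x |-> a x *)
Definition free_ev M : 'Hom(freemod M, M) :=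
  linfun (tlift (@act k A M) : freemod M -> M).

Lemma free_evE M t : free_ev M t = tlift (@act k A M) t.
Proof. exact/linfunP/tlift_linear. Qed.

Lemma free_evA M : free_ev M \in homA (freemod M) M.
Proof.
have [Ml Mr] := act_bilin M.
apply/homAP => a t; rewrite !free_evE /=.
apply: (tens_eq (f := fun t => tlift _ (free_act a t))
                (g := fun t => act a (tlift _ t))) => [c s u|c s u|b v].
- by rewrite (free_act_bilin M).2 tlift_linear.
- by rewrite tlift_linear Mr.
- rewrite /free_act tmap_pure //; last by move=> c x y; rewrite mulrDr scalerAr.
  by rewrite !tlift_pure ?actM.
Qed.

Lemma free_ev_onto M : limg (free_ev M) = fullv.
Proof.
apply/vspaceP => x; rewrite memvf.
have -> : x = free_ev M ((1 : A) \ot x : tens A M).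
  by rewrite free_evE tlift_pure ?act1 //; exact: act_bilin.
exact/memv_img/memvf.
Qed.

Section Kernel.
Variables (M N : amod A) (f : 'Hom(M, N)).
Hypothesis fA : f \in homA M N.

Definition ker_act (a : A) (x : subvs_of (lker f)) : subvs_of (lker f) :=
  vsproj (lker f) (act a (vsval x)).

Lemma ker_actE a x : vsval (ker_act a x) = act a (vsval x).
Proof.
rewrite /ker_act vsprojK // memv_ker (elimT (homAP _) fA).
have /eqP-> : f (vsval x) == 0 by rewrite -memv_ker; exact: subvsP.
by rewrite (lin0 ((act_bilin N).2 a)).
Qed.

Lemma ker_act_bilin : bilin ker_act.
Proof.
have [Ml Mr] := act_bilin M.
split=> [x c a b|a c x y]; apply: subvs_inj;
by rewrite linearP /= !ker_actE ?linearP (Ml, Mr).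
Qed.

Lemma ker_act1 x : ker_act 1 x = x.
Proof. by apply: subvs_inj; rewrite ker_actE act1. Qed.

Lemma ker_actM a b x : ker_act (a * b) x = ker_act a (ker_act b x).
Proof. by apply: subvs_inj; rewrite !ker_actE actM. Qed.

Definition kermod := AMod ker_act_bilin ker_act1 ker_actM.

Definition ker_incl : 'Hom(kermod, M) := linfun (vsval : kermod -> M).

End Kernel.

(* The standard free resolution: P_n = A (x) syz_n, syz_0 = M and syz_{n+1} *)
(* is the kernel of P_n ->> syz_n.                                          *)
Definition syz M (n : nat) : amod A :=
  iter n (fun K => kermod (free_evA K)) M.

Definition std_d M n : 'Hom(freemod (syz M n.+1), freemod (syz M n)) :=
  (ker_incl (free_evA (syz M n)) \o free_ev (syz M n.+1))%VF.

Lemma std_dE M n t : std_d M n t = vsval (free_ev (syz M n.+1) t).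
Proof. rewrite /std_d comp_lfunE /ker_incl linfunP //; exact: linearP. Qed.

Lemma std_dA M n :
  std_d M n \in homA (freemod (syz M n.+1)) (freemod (syz M n)).
Proof.
apply/homAP => a t; rewrite !std_dE (elimT (homAP _) (free_evA _)).
exact: (ker_actE (free_evA _)).
Qed.

Lemma std_exact0 M n : limg (std_d M n) = lker (free_ev (syz M n)).
Proof.
apply/vspaceP => x; apply/idP/idP => [/memv_imgP[t _ ->]|xK].
  by rewrite std_dE subvsP.
have: (Subvs xK : syz M n.+1) \in limg (free_ev (syz M n.+1)).
  by rewrite free_ev_onto memvf.
case/memv_imgP=> t _ E; apply/memv_imgP; exists t; rewrite ?memvf // std_dE.
by rewrite -E.
Qed.

Lemma std_exact M n : limg (std_d M n.+1) = lker (std_d M n).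
Proof.
rewrite std_exact0; apply/vspaceP => x; rewrite !memv_ker std_dE.
by rewrite -[0 in RHS](linear0 (@vsval _ _ (lker (free_ev (syz M n)))))
           (inj_eq (@subvs_inj _ _ _)).
Qed.

Definition std_res M : projres M :=
  @ProjRes M (fun n => freemod (syz M n)) (std_d M) (free_ev M)
    (fun n => @freemod_proj (syz M n)) (std_dA M) (free_evA M)
    (std_exact M) (std_exact0 M 0) (free_ev_onto M).

End Modules.

Section VQuot.
Variables (k : fieldType) (V : vectType k) (U : {vspace V}).

Definition vquot := Quotient.quot (pred_of_vspace U).

HB.instance Definition _ := GRing.Zmodule.on vquot.
HB.instance Definition _ := EqQuotient.on vquot.

Definition vpi (x : V) : vquot := (\pi_vquot x)%qT.

Lemma vpi_eq x y : (vpi x = vpi y) <-> (x - y \in U).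
Proof.
split=> [/eqP|xyU]; last apply/eqP.
  by rewrite -(Quotient.idealrBE (pred_of_vspace U)).
by rewrite -(Quotient.idealrBE (pred_of_vspace U)).
Qed.

Lemma vpi_repr (x : vquot) : vpi (repr x) = x.
Proof. exact: reprK. Qed.

Lemma vpiD x y : vpi (x + y) = vpi x + vpi y.
Proof. exact: (Quotient.pi_add (pred_of_vspace U)). Qed.

Definition vquot_scale (c : k) (x : vquot) : vquot := vpi (c *: repr x).

Lemma vpiZ c x : vquot_scale c (vpi x) = vpi (c *: x).
Proof.
by apply/vpi_eq; rewrite -scalerBr memvZ //; apply/vpi_eq; rewrite vpi_repr.
Qed.

Fact vquot_scaleA a b x :
  vquot_scale a (vquot_scale b x) = vquot_scale (a * b) x.
Proof. by rewrite -[x]vpi_repr !vpiZ scalerA. Qed.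

Fact vquot_scale1 : left_id 1 vquot_scale.
Proof. by move=> x; rewrite -[x]vpi_repr !vpiZ scale1r. Qed.

Fact vquot_scaleDr : right_distributive vquot_scale +%R.
Proof.
by move=> c x y; rewrite -[x]vpi_repr -[y]vpi_repr -vpiD !vpiZ scalerDr vpiD.
Qed.

Fact vquot_scaleDl x : {morph vquot_scale^~ x : a b / a + b}.
Proof. by move=> a b; rewrite -[x]vpi_repr !vpiZ scalerDl vpiD. Qed.

HB.instance Definition _ := GRing.Zmodule_isLmodule.Build k vquot
  vquot_scaleA vquot_scale1 vquot_scaleDr vquot_scaleDl.

Lemma vpi_is_linear : linear vpi.
Proof. by move=> c x y; rewrite vpiD -vpiZ. Qed.

HB.instance Definition _ := GRing.isLinear.Build k V vquot _ vpi vpi_is_linear.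

End VQuot.
(* Ext^n_A(M, N) = H^n(Hom_A(P, N)), P the projective resolution std_res M. *)

Section Ext.
Variables (k : fieldType) (A : falgType k).
Implicit Types L M N : amod A.

Definition cochain M N n : vectType k := 'Hom(std_res M n, N).

Definition codiff M N n (f : cochain M N n) : cochain M N n.+1 :=
  (f \o res_d (std_res M) n)%VF.

Lemma codiff_linear M N n : linear (@codiff M N n).
Proof.
by move=> c f g; rewrite /codiff comp_lfunDl -comp_lfunZl.
Qed.

Definition cocycles M N n : {vspace cochain M N n} :=
  (homA (std_res M n) N :&: lker (linfun (@codiff M N n)))%VS.

Lemma cocyclesP M N n (f : cochain M N n) :
  reflect (f \in homA (std_res M n) N /\ (f \o res_d (std_res M) n)%VF = 0)
          (f \in cocycles M N n).
Proof.
rewrite memv_cap memv_ker (linfunP (@codiff_linear M N n)).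
by apply: (iffP andP) => -[fA /eqP].
Qed.

Definition coboundaries M N n : {vspace cochain M N n} :=
  match n with
  | 0 => 0%VS
  | m.+1 => (linfun (@codiff M N m) @: homA (std_res M m) N)%VS
  end.

Definition cobound M N n : {vspace subvs_of (cocycles M N n)} :=
  (linfun (vsval : subvs_of (cocycles M N n) -> cochain M N n)
     @^-1: coboundaries M N n)%VS.

Definition ext M N n : lmodType k := vquot (cobound M N n).

(* The cohomology class of f, meaningful when f is a cocycle *)
Definition cls M N n (f : cochain M N n) : ext M N n :=
  vpi (cobound M N n) (vsproj (cocycles M N n) f).

Definition represents M N n (f : cochain M N n) (x : ext M N n) : Prop :=
  f \in cocycles M N n /\ cls f = x.

(* phi lifts the cocycle g : P_q -> N to a chain map from the q-th shift of *)
(* the resolution P of M to the resolution of N.                            *)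
Definition lifting M N q (g : cochain M N q)
    (phi : forall i, 'Hom(std_res M (i + q), std_res N i)) : Prop :=
  [/\ forall i, phi i \in homA (std_res M (i + q)) (std_res N i),
      (res_aug (std_res N) \o phi 0)%VF = g &
      forall i, (res_d (std_res N) i \o phi i.+1)%VF =
                (phi i \o res_d (std_res M) (i + q))%VF].

(* Yoneda composition: [f] o [g] = [f o phi_p] for any lifting phi of g.    *)
(* By the comparison theorem, liftings exist and the class obtained depends *)
(* only on [f] and [g], so xget picks the only element of the set.          *)
Definition yoneda M N L p q (x : ext N L p) (y : ext M N q) :
    ext M L (p + q) :=
  xget 0 [set z | exists f g phi,
    [/\ represents f x, represents g y, @lifting M N q g phi &
        z = cls ((f \o phi p)%VF : cochain M L (p + q))]].

Definition ext_cast M N m n (e : m = n) (x : ext M N m) : ext M N n :=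
  ecast i (ext M N i) e x.

(* The direct sum of the Ext^n_A(M, N) is the subspace finite_support of    *)
(* their product.                                                           *)
Definition extprod M N := forall n, ext M N n.

Definition finite_support M N (y : extprod M N) : Prop :=
  exists b : nat, forall n, (b <= n)%N -> y n = 0.

End Ext.

Section HopfModules.
Variables (k : fieldType) (A : hopfAlg k).
Implicit Types M N : amod A.

Definition triv_act (a : A) (c : k^o) : k^o := counit A a * c.

Lemma triv_act_bilin : bilin triv_act.
Proof.
split=> [c d a b|a d c c']; rewrite /triv_act.
  by rewrite linearP mulrDl -scalerAl.
by rewrite mulrDr -scalerAr.
Qed.

Lemma triv_act1 c : triv_act 1 c = c.
Proof. by rewrite /triv_act counit1 mul1r. Qed.

Lemma triv_actM a b c : triv_act (a * b) c = triv_act a (triv_act b c).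
Proof. by rewrite /triv_act counitM mulrA. Qed.

Definition triv : amod A := AMod triv_act_bilin triv_act1 triv_actM.

Section TensorModule.
Variables M N : amod A.

(* (a \ot b) (x \ot y) = a x \ot b y, the action of A (x) A on M (x) N *)
Definition tact (s : tens A A) (t : tens M N) : tens M N :=
  tlift (fun a b : A => tmap (@act k A M a) (@act k A N b) t) s.

Let act2_bilin t :
  bilin (fun a b : A => tmap (@act k A M a) (@act k A N b) t).
Proof.
have [Tl Tr] := tensv_bilin M N.
have [[Ml _] [Nl _]] := (act_bilin M, act_bilin N).
split=> [b|a].
  apply: (@tlift_lin_param _ _ _ _ A (fun a x y => act a x \ot act b y)).
  by move=> x y c a a'; rewrite Ml Tl.
apply: (@tlift_lin_param _ _ _ _ A (fun b x y => act a x \ot act b y)).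
by move=> x y c b b'; rewrite Nl Tr.
Qed.

Lemma tact_bilin : bilin tact.
Proof.
split=> [t|s]; first exact: tlift_linear.
apply: (@tlift_lin_param _ _ _ _ (tens M N)
          (fun t (a b : A) => tmap (@act k A M a) (@act k A N b) t)) => a b.
exact: tlift_linear.
Qed.

Lemma tact_pure a b x y : tact (a \ot b) (x \ot y) = act a x \ot act b y.
Proof.
by rewrite /tact (tlift_pure _ _ (act2_bilin _)) tmap_pure //;
  [exact: (act_bilin M).2 | exact: (act_bilin N).2].
Qed.

Lemma tmul_bilin : bilin (@tmul k A).
Proof.
split=> [t|s]; first exact: tlift_linear.
apply: (@tlift_lin_param _ _ _ _ (tens A A)
  (fun t (a b : A) => tlift (fun c d : A => (a * c) \ot (b * d)) t)) => a b.
exact: tlift_linear.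
Qed.

Lemma tmul_pure (a b c d : A) :
  tmul (a \ot b) (c \ot d) = (a * c) \ot (b * d) :> tens A A.
Proof.
have [Tl Tr] := tensv_bilin A A.
rewrite /tmul /tmulg tlift_pure; last first.
  split=> [y|x].
    apply: (@tlift_lin_param _ _ _ _ A
              (fun (x u v : A) => (x * u) \ot (y * v))) => u v e x x'.
    by rewrite mulrDl -scalerAl Tl.
  apply: (@tlift_lin_param _ _ _ _ A
            (fun (y u v : A) => (x * u) \ot (y * v))) => u v e y y'.
  by rewrite mulrDl -scalerAl Tr.
rewrite tlift_pure //; split=> [v e u u'|u e v v'] /=.
  by rewrite mulrDr -scalerAr Tl.
by rewrite mulrDr -scalerAr Tr.
Qed.

Lemma tactM s s' t : tact (tmul s s') t = tact s (tact s' t).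
Proof.
have [[Al Ar] [Bl Br]] := (tact_bilin, tmul_bilin).
apply: (tens_eq (f := fun s => tact (tmul s s') t)
                (g := fun s => tact s (tact s' t))) => [c u v|c u v|a b].
- by rewrite Bl Al.
- by rewrite Al.
apply: (tens_eq (f := fun s' => tact (tmul (a \ot b) s') t)
                (g := fun s' => tact (a \ot b) (tact s' t)))
  => [e u v|e u v|c d].
- by rewrite Br Al.
- by rewrite Al Ar.
apply: (tens_eq (f := fun t => tact (tmul (a \ot b) (c \ot d)) t)
                (g := fun t => tact (a \ot b) (tact (c \ot d) t)))
  => [e u v|e u v|x y].
- by rewrite Ar.
- by rewrite !Ar.
by rewrite tmul_pure !tact_pure !actM.
Qed.

Definition tens_act (a : A) (t : tens M N) : tens M N := tact (comul A a) t.

Lemma tens_act_bilin : bilin tens_act.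
Proof.
split=> [t c a b|a c t u]; rewrite /tens_act ?linearP ?tact_bilin.1 //.
by rewrite tact_bilin.2.
Qed.

Lemma tens_act1 t : tens_act 1 t = t.
Proof.
rewrite /tens_act comul1; apply: (tens_eq (f := tact _) (g := id)) => //.
  exact: tact_bilin.2.
by move=> x y; rewrite tact_pure !act1.
Qed.

Lemma tens_actM a b t : tens_act (a * b) t = tens_act a (tens_act b t).
Proof. by rewrite /tens_act comulM tactM. Qed.

Definition amod_tens : amod A := AMod tens_act_bilin tens_act1 tens_actM.

End TensorModule.

Definition tensr M M' N (f : 'Hom(M, M')) :
    'Hom(amod_tens M N, amod_tens M' N) :=
  linfun (tmap f (id : N -> N) : amod_tens M N -> amod_tens M' N).

(* The isomorphism k (x) N -> N *)
Definition unitl N : 'Hom(amod_tens triv N, N) :=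
  linfun (tlift (fun (c : k^o) (x : N) => c *: x) : amod_tens triv N -> N).

(* psi is a chain map over the identity of N from the resolution of N to    *)
(* P (x) N, where P is the resolution of k and k (x) N is identified with N. *)
Definition tens_lifting N
    (psi : forall i, 'Hom(std_res N i, amod_tens (std_res triv i) N)) : Prop :=
  [/\ forall i, psi i \in homA (std_res N i) (amod_tens (std_res triv i) N),
      (unitl N \o tensr N (res_aug (std_res triv)) \o psi 0)%VF =
        res_aug (std_res N) &
      forall i, (tensr N (res_d (std_res triv) i) \o psi i.+1)%VF =
                (psi i \o res_d (std_res N) i)%VF].

(* - (x) N : Ext^n_A(k, k) -> Ext^n_A(N, N). It applies the exact functor   *)
(* - (x) N to a cocycle f : P_n -> k and transports the result along psi to *)
(* the resolution of N; as in yoneda, the class does not depend on choices. *)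
Definition ext_tensr N n (z : ext triv triv n) : ext N N n :=
  xget 0 [set w | exists (f : cochain triv triv n) psi,
    [/\ represents f z, @tens_lifting N psi &
        w = cls ((unitl N \o tensr N f \o psi n)%VF : cochain N N n)]].

Definition hprod := extprod triv triv.

(* The action of H^*(A, k) on Ext^*_A(M, N) and the product of H^*(A, k).   *)
(* The degree n component only involves the components of degree at most n, *)
(* so these are defined without assuming finite support.                    *)
Definition hact M N (h : hprod) (y : extprod M N) : extprod M N :=
  fun n => \sum_(i < n.+1) ext_cast (subnK (leq_ord i))
             (yoneda (ext_tensr N (h (n - i)%N)) (y i)).

Definition hmul (x y : hprod) : hprod :=
  fun n => \sum_(i < n.+1) ext_cast (subnK (leq_ord i))
             (yoneda (x (n - i)%N) (y i)).

Definition hone : hprod :=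
  fun n => if n is 0 then cls (res_aug (std_res triv) : cochain triv triv 0)
           else 0.

Definition hadd (x y : hprod) : hprod := fun n => x n + y n.
Definition hscale (c : k) (x : hprod) : hprod := fun n => c *: x n.
Definition hzero : hprod := fun n => 0.

Definition Hev : set hprod :=
  [set x | finite_support x /\ forall n, odd n -> x n = 0].

(* H^ev(A, k) is a subset of hprod, so its ideals and subalgebras are given *)
(* by explicit closure conditions. The clause on k-scaling is not needed in *)
(* ideal, as H^ev(A, k) contains the scalar multiples of hone.              *)
Definition ideal (I : set hprod) : Prop :=
  [/\ I `<=` Hev, I hzero,
      forall x y, I x -> I y -> I (hadd x y) &
      forall x y, Hev x -> I y -> I (hmul x y) /\ I (hmul y x)].

Definition maximal_ideal (m : set hprod) : Prop :=
  [/\ ideal m, m <> Hev &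
      forall J, ideal J -> m `<=` J -> J = m \/ J = Hev].

Definition subalgebra (S : set hprod) : Prop :=
  [/\ S `<=` Hev, S hone,
      forall c x, S x -> S (hscale c x),
      forall x y, S x -> S y -> S (hadd x y) &
      forall x y, S x -> S y -> S (hmul x y)].

Definition Hev_finitely_generated : Prop :=
  exists (m : nat) (g : 'I_m -> hprod),
    (forall i, Hev (g i)) /\
    forall S, subalgebra S -> (forall i, S (g i)) -> Hev `<=` S.

Definition Ext_finitely_generated M N : Prop :=
  exists (m : nat) (g : 'I_m -> extprod M N),
    (forall i, finite_support (g i)) /\
    forall y : extprod M N, finite_support y ->
      exists h : 'I_m -> hprod,
        (forall i, Hev (h i)) /\ forall n, y n = \sum_i hact (h i) (g i) n.

Definition annihilator M : set hprod :=
  [set h | Hev h /\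
     forall y : extprod M M, finite_support y -> forall n, hact h y n = 0].

Definition support_variety M : set (set hprod) :=
  [set m | maximal_ideal m /\ annihilator M `<=` m].

End HopfModules.

(* Main.v *)
(** Testing on the identity class in degree 0, [h] annihilates Ext(X, X) iff
    every component of [h] is killed by [- (x) X].  If a cocycle [f : P_n -> k]
    becomes a coboundary after [- (x) M] and transport to the resolution of [M],
    it stays one after tensoring further with [N].  As [- (x) N] is exact, the
    comparison theorem applies to the resolution of [M] tensored with [N], and
    the same holds for [M (x) N] and for any retract of it.  So the annihilator of [M]
    lies in that of [M (x) N], and the annihilator of [N] lies in that of
    [N (x) M], of which [M (x) N] is a retract by means of the R-matrix. *)
Require Import Defs.
From mathcomp Require Import all_boot all_order all_algebra all_field.
From mathcomp Require Import boolp classical_sets.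

Set Implicit Arguments.
Unset Strict Implicit.
Unset Printing Implicit Defensive.

Import GRing.Theory.

Local Open Scope ring_scope.

(** * Degreewise choice and linear algebra over a field *)

(** Chain maps and homotopies are built one degree at a time. [S] is the invariant that makes the
    next component exist, and [R] is the equation linking consecutive components. The recursion runs
    on elements bundled with a proof of [S]. *)
Lemma dependent_choice_seq (T : nat -> Type) (S : forall n, T n -> Prop)
    (R : forall n, T n -> T n.+1 -> Prop) (x0 : T 0) :
  S 0 x0 -> (forall n x, S n x -> exists2 y, S n.+1 y & R n x y) ->
  exists s : forall n, T n,
    [/\ s 0 = x0, forall n, S n (s n) & forall n, R n (s n) (s n.+1)].
Proof.
move=> Sx0 step.
pose F n (u : {x | S n x}) := cid2 (step n (sval u) (svalP u)).
pose s := fix s n : {x | S n x} := match n with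
  | 0 => exist _ x0 Sx0
  | m.+1 => exist _ (s2val (F m (s m))) (s2valP (F m (s m))) end.
exists (fun n => sval (s n)); split=> // n; first exact: svalP.
exact: (s2valP' (F n (s n))).
Qed.

(** Over a field exactness splits: the pseudo-inverses of [f] and [g] give the identity of [V] as
    [f s + r g]. An identity of this kind survives tensoring. *)
Lemma linear_retract (k : fieldType) (U V W : vectType k) (f : 'Hom(U, V))
    (g : 'Hom(V, W)) : (lker g <= limg f)%VS ->
  exists (s : 'Hom(V, U)) (r : 'Hom(W, V)), forall v, v = f (s v) + r (g v).
Proof.
move=> sub; exists (f^-1 \o (\1%VF - (g^-1 \o g)%VF))%VF, (g^-1)%VF => v.
rewrite comp_lfunE limg_lfunVK ?add_lfunE ?opp_lfunE ?comp_lfunE ?id_lfunE ?subrK //.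
apply: (subvP sub); rewrite memv_ker linearB /= limg_lfunVK ?subrr //.
exact/memv_img/memvf.
Qed.

Lemma limg_lker_comp0 (k : fieldType) (U V W : vectType k) (f : 'Hom(U, V)) (g : 'Hom(V, W)) :
  limg f = lker g -> (g \o f)%VF = 0.
Proof.
move=> ex; apply/lfunP => x; rewrite comp_lfunE !lfunE /=; apply/eqP.
by rewrite -memv_ker -ex; exact/memv_img/memvf.
Qed.

(** * Comparison theorem *)

Section Comparison.
Variables (k : fieldType) (A : falgType k).
Implicit Types L M N X Y : amod A.

Lemma homA_id M : \1%VF \in homA M M.
Proof. by apply/homAP => a x; rewrite !id_lfunE. Qed.

Lemma homA_comp L M N (f : 'Hom(M, N)) (g : 'Hom(L, M)) :
  f \in homA M N -> g \in homA L M -> (f \o g)%VF \in homA L N.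
Proof. by move=> /homAP fA /homAP gA; apply/homAP => a x; rewrite !comp_lfunE gA fA. Qed.

(** [projective] only speaks of surjections. Exactness makes [f] onto the kernel module of [g], and
    [u] lands in that kernel, so [u] lifts once both maps are corestricted. *)
Lemma projective_lift (P L M N : amod A) (f : 'Hom(L, M)) (g : 'Hom(M, N))
    (u : 'Hom(P, M)) :
  projective P -> f \in homA L M -> g \in homA M N -> u \in homA P M ->
  limg f = lker g -> (g \o u)%VF = 0 ->
  exists2 v : 'Hom(P, L), v \in homA P L & (f \o v)%VF = u.
Proof.
move=> Pp fA gA uA ex gu0.
have piE X (w : 'Hom(X, M)) x : (g \o w)%VF = 0 ->
    vsval (vsproj (lker g) (w x)) = w x.
  by move=> gw; rewrite vsprojK // memv_ker -comp_lfunE gw lfunE.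
have gf0 := limg_lker_comp0 ex.
(* The corestriction to the kernel of [g]. As [vsproj] is a total function, it agrees with [w] only
   when [g \o w] vanishes. *)
pose cor X (w : 'Hom(X, M)) : 'Hom(X, kermod gA) :=
  linfun (fun x => vsproj (lker g) (w x) : kermod gA).
have corE X (w : 'Hom(X, M)) x : (g \o w)%VF = 0 -> vsval (cor X w x) = w x.
  move=> gw; rewrite linfunP; first exact: piE.
  by move=> c y z; rewrite !linearP.
have corA X (w : 'Hom(X, M)) : (g \o w)%VF = 0 -> w \in homA X M ->
    cor X w \in homA X (kermod gA).
  move=> gw /homAP wA; apply/homAP => a x; apply: subvs_inj.
  by rewrite corE // wA (ker_actE gA) corE.
have [] := Pp L (kermod gA) (cor L f) (cor P u).
- exact: corA.
- apply/vspaceP => x; rewrite memvf.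
  have /memv_imgP[y _ E] : vsval x \in limg f by rewrite ex subvsP.
  apply/memv_imgP; exists y; rewrite ?memvf //.
  by apply: subvs_inj; rewrite corE.
- exact: corA.
move=> v vA E; exists v => //; apply/lfunP => x.
by have := congr1 (fun h : 'Hom(P, kermod gA) => vsval (h x)) E; rewrite !comp_lfunE !corE.
Qed.

(** A resolution with no projectivity required of its terms. The target of a comparison map has to
    be exact only, which lets tensored resolutions serve as targets. *)
Definition exact_augmented (D : nat -> amod A) (d : forall i, 'Hom(D i.+1, D i))
    (Y : amod A) (e : 'Hom(D 0, Y)) : Prop :=
  [/\ forall i, d i \in homA (D i.+1) (D i), e \in homA (D 0) Y,
      limg e = fullv, limg (d 0) = lker e &
      forall i, limg (d i.+1) = lker (d i)].

Section ChainMaps.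
Variables (C : nat -> amod A) (dC : forall i, 'Hom(C i.+1, C i)).
Hypothesis C_proj : forall i, projective (C i).
Hypothesis dC_A : forall i, dC i \in homA (C i.+1) (C i).
Hypothesis dC2 : forall i, (dC i \o dC i.+1)%VF = 0.
Variables (D : nat -> amod A) (dD : forall i, 'Hom(D i.+1, D i)).
Variables (Y : amod A) (e : 'Hom(D 0, Y)).
Hypothesis D_ex : exact_augmented dD e.

(** The source is a complex of projectives, not necessarily exact, so that shifted resolutions are
    covered. *)
Lemma comparison_exists (g : 'Hom(C 0, Y)) :
  g \in homA (C 0) Y -> (g \o dC 0)%VF = 0 ->
  exists phi : forall i, 'Hom(C i, D i),
    [/\ forall i, phi i \in homA (C i) (D i), (e \o phi 0)%VF = g &
        forall i, (dD i \o phi i.+1)%VF = (phi i \o dC i)%VF].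
Proof.
case: D_ex => dA eA e_onto ex0 ex gA gd.
have [phi0 phi0A E0] := C_proj eA e_onto gA.
(* The invariant says that [p \o dC i] is killed by the next map down, the augmentation when [i = 0]
   and a differential otherwise. By exactness it then lifts to degree [i.+1]. *)
pose S i : 'Hom(C i, D i) -> Prop := match i with
  | 0 => fun p => p \in homA (C 0) (D 0) /\ (e \o (p \o dC 0))%VF = 0
  | j.+1 => fun p => p \in homA (C j.+1) (D j.+1) /\
                     (dD j \o (p \o dC j.+1))%VF = 0
  end.
have SA i p : S i p -> p \in homA (C i) (D i) by case: i p => [|i] p [].
pose R i (p : 'Hom(C i, D i)) (p' : 'Hom(C i.+1, D i.+1)) :=
  (dD i \o p')%VF = (p \o dC i)%VF.
have [||phi [phiE SS RR]] := @dependent_choice_seq _ S R phi0.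
- by split=> //; rewrite comp_lfunA E0.
- move=> i p Sp.
  have [p' p'A E] : exists2 v : 'Hom(C i.+1, D i.+1),
      v \in homA (C i.+1) (D i.+1) & (dD i \o v)%VF = (p \o dC i)%VF.
    have pA := homA_comp (SA i p Sp) (dC_A i).
    case: i p Sp pA => [|i] p [_ Sp] pA.
      exact: (projective_lift (@C_proj 1%N) (dA 0) eA pA ex0 Sp).
    exact: (projective_lift (@C_proj i.+2) (dA i.+1) (dA i) pA (ex i) Sp).
  by exists p' => //; split=> //; rewrite comp_lfunA E -comp_lfunA dC2 comp_lfun0r.
by exists phi; split=> [i||//]; [exact: SA | rewrite phiE].
Qed.

(* The correction [u] is what remains of a homotopy whose component in degree *)
(* -1 is prescribed.                                                          *)
Lemma comparison_homotopy (phi : forall i, 'Hom(C i, D i)) (u : 'Hom(C 0, D 0)) :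
  (forall i, phi i \in homA (C i) (D i)) -> u \in homA (C 0) (D 0) ->
  (forall i, (dD i \o phi i.+1)%VF = (phi i \o dC i)%VF) ->
  (e \o phi 0)%VF = (e \o u)%VF -> (u \o dC 0)%VF = 0 ->
  exists t : forall i, 'Hom(C i, D i.+1),
    [/\ forall i, t i \in homA (C i) (D i.+1),
        phi 0 = (u + (dD 0 \o t 0))%VF &
        forall i, phi i.+1 = ((t i \o dC i) + (dD i.+1 \o t i.+1))%VF].
Proof.
case: D_ex => dA eA e_onto ex0 ex phiA uA phid eu ud.
have [||t0 t0A E0] := projective_lift (u := phi 0 - u) (@C_proj 0) (dA 0) eA _ ex0.
- exact: memvB (phiA 0) uA.
- by rewrite comp_lfunDr comp_lfunNr eu subrr.
(* With this invariant [dD i] kills the defect [phi i.+1 - t \o dC i], which therefore lifts to the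
   next component of the homotopy. In degree 0 it holds because [u \o dC 0 = 0]. *)
pose S i (t : 'Hom(C i, D i.+1)) :=
  t \in homA (C i) (D i.+1) /\ (dD i \o (t \o dC i))%VF = (phi i \o dC i)%VF.
pose R i (t : 'Hom(C i, D i.+1)) (t' : 'Hom(C i.+1, D i.+2)) :=
  (dD i.+1 \o t')%VF = phi i.+1 - (t \o dC i)%VF.
have [||t [tE SS RR]] := @dependent_choice_seq _ S R t0.
- by split=> //; rewrite comp_lfunA E0 comp_lfunDl comp_lfunNl ud subr0.
- move=> i t [tA tE].
  have [||t' t'A E'] := projective_lift (u := phi i.+1 - (t \o dC i)%VF)
      (@C_proj i.+1) (dA i.+1) (dA i) _ (ex i).
  + exact: memvB (phiA _) (homA_comp tA (dC_A _)).
  + by rewrite comp_lfunDr comp_lfunNr tE phid subrr.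
  exists t' => //; split=> //.
  by rewrite comp_lfunA E' comp_lfunDl comp_lfunNl -comp_lfunA dC2 comp_lfun0r subr0.
exists t; split=> [i||i]; first by case: (SS i).
  by rewrite tE E0 addrC subrK.
by rewrite RR addrC subrK.
Qed.

End ChainMaps.
End Comparison.

(** * Yoneda composition *)

Section ExtClasses.
Variables (k : fieldType) (A : falgType k).
Implicit Types L M N : amod A.

Lemma res_exact_augmented M (P : projres M) : exact_augmented (res_d P) (res_aug P).
Proof.
by split; [exact: res_dA | exact: res_augA | exact: res_onto | exact: res_exact0
          | exact: res_exact].
Qed.

Lemma res_dd M (P : projres M) n : (res_d P n \o res_d P n.+1)%VF = 0.
Proof. exact/limg_lker_comp0/res_exact. Qed.

Lemma res_aug_d M (P : projres M) : (res_aug P \o res_d P 0)%VF = 0.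
Proof. exact/limg_lker_comp0/res_exact0. Qed.

Lemma coboundaries0P M N (f : cochain M N 0) : f \in coboundaries M N 0 <-> f = 0.
Proof. by rewrite memv0; split=> [/eqP|->]. Qed.

Lemma coboundariesSP M N n (f : cochain M N n.+1) :
  f \in coboundaries M N n.+1 <->
  exists2 g, g \in homA (std_res M n) N & f = (g \o res_d (std_res M) n)%VF.
Proof.
split=> [/memv_imgP[g gA ->]|[g gA ->]].
  by exists g; rewrite // (linfunP (@codiff_linear _ _ M N n)).
by apply/memv_imgP; exists g; rewrite // (linfunP (@codiff_linear _ _ M N n)).
Qed.

Lemma coboundaries_cocycles M N n (f : cochain M N n) :
  f \in coboundaries M N n -> f \in cocycles M N n.
Proof.
case: n f => [|n] f; first by move/coboundaries0P->; exact: mem0v.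
case/coboundariesSP=> g gA ->; apply/cocyclesP; split.
  exact: homA_comp gA (res_dA _ _).
by rewrite -comp_lfunA res_dd comp_lfun0r.
Qed.

Lemma cls_eqP M N n (f g : cochain M N n) :
  f \in cocycles M N n -> g \in cocycles M N n ->
  cls f = cls g <-> f - g \in coboundaries M N n.
Proof.
move=> fZ gZ; rewrite /cls vpi_eq -linearB -memv_preim linfunP; last exact: linearP.
by rewrite vsprojK // memvB.
Qed.

Lemma cls0 M N n : cls (0 : cochain M N n) = 0.
Proof. by rewrite /cls !linear0. Qed.

Lemma cls_eq0P M N n (f : cochain M N n) :
  f \in cocycles M N n -> cls f = 0 <-> f \in coboundaries M N n.
Proof. by move=> fZ; rewrite -[0](cls0 M N n) cls_eqP ?mem0v // subr0. Qed.

Lemma cls_coboundary M N n (f : cochain M N n) : f \in coboundaries M N n -> cls f = 0.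
Proof. by move=> fB; apply/cls_eq0P => //; exact: coboundaries_cocycles. Qed.

Lemma represents_exists M N n (x : ext M N n) : exists f, represents f x.
Proof.
exists (vsval (repr x)); split; first exact: subvsP.
by rewrite /cls vsvalK vpi_repr.
Qed.

Lemma represents0P M N n (f : cochain M N n) :
  represents f 0 <-> f \in coboundaries M N n.
Proof.
split=> [[fZ]|fB]; first exact: (cls_eq0P fZ).1.
by split; [exact: coboundaries_cocycles | exact: cls_coboundary].
Qed.

Lemma represents_unique M N n (f g : cochain M N n) x :
  represents f x -> represents g x -> f - g \in coboundaries M N n.
Proof. by move=> [fZ fx] [gZ gx]; apply/(cls_eqP fZ gZ); rewrite fx. Qed.

Lemma aug_cocycle M : res_aug (std_res M) \in cocycles M M 0.
Proof. by apply/cocyclesP; split; [exact: res_augA | exact: res_aug_d]. Qed.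

(** The shift by [q] of the resolution of [M] is still a complex of projectives, and the cocycle
    condition on [g] is the condition needed in degree 0. *)
Lemma lifting_exists M N q (g : cochain M N q) :
  g \in cocycles M N q -> exists phi, @lifting _ _ M N q g phi.
Proof.
move=> /cocyclesP[gA gd].
apply: (comparison_exists (C := fun i => std_res M (i + q)%N)
  (dC := fun i => res_d (std_res M) (i + q)%N)) gA gd => [i|i|i|].
- exact: res_proj.
- exact: res_dA.
- exact: res_dd.
- exact: res_exact_augmented.
Qed.

Section Lifting.
Variables (M N L : amod A) (p q : nat).
Implicit Type phi : forall i, 'Hom(std_res M (i + q)%N, std_res N i).

Lemma lifting_comp_cocycle g phi (f : cochain N L p) :
  @lifting _ _ M N q g phi -> f \in cocycles N L p ->
  ((f \o phi p)%VF : cochain M L (p + q)%N) \in cocycles M L (p + q)%N.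
Proof.
move=> [phiA _ phid] /cocyclesP[fA fd]; apply/cocyclesP; split.
  exact: homA_comp.
by rewrite -comp_lfunA -phid comp_lfunA fd comp_lfun0l.
Qed.

Lemma lifting_comp_coboundary g phi (f : cochain N L p) :
  @lifting _ _ M N q g phi -> f \in coboundaries N L p ->
  ((f \o phi p)%VF : cochain M L (p + q)%N) \in coboundaries M L (p + q)%N.
Proof.
move=> [phiA _ phid]; case: p f => [|p'] f.
  by move/coboundaries0P->; rewrite comp_lfun0l mem0v.
case/coboundariesSP=> h hA ->; apply/coboundariesSP.
exists (h \o phi p')%VF; first exact: homA_comp.
by rewrite -comp_lfunA phid comp_lfunA.
Qed.

(** The difference of the liftings covers the coboundary [g - g'], so it is null-homotopic up to a
    correction [u]. The cocycle [f] kills the summand of the homotopy formula that begins with a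
    differential. *)
Lemma lifting_comp_unique g g' phi phi' (f : cochain N L p) :
  @lifting _ _ M N q g phi -> @lifting _ _ M N q g' phi' ->
  g - g' \in coboundaries M N q -> f \in cocycles N L p ->
  ((f \o phi p)%VF - (f \o phi' p)%VF : cochain M L (p + q)%N)
    \in coboundaries M L (p + q)%N.
Proof.
move=> [phiA phi0 phid] [phiA' phi0' phid'] gg' /cocyclesP[fA fd].
(* If [q = 0], the only coboundary is 0 and [u = 0] works. If [q > 0], write [g - g'] as [h] after a
   differential, lift [h] through the augmentation of the resolution of [N] to [s], and let [u] be
   [s] after that differential. *)
have [u [uA ud eu fu]] : exists u : 'Hom(std_res M (0 + q)%N, std_res N 0),
    [/\ u \in homA (std_res M (0 + q)%N) (std_res N 0),
        (u \o res_d (std_res M) (0 + q)%N)%VF = 0,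
        (res_aug (std_res N) \o u)%VF = g - g' &
        forall f : 'Hom(std_res N 0, L), f \in homA (std_res N 0) L ->
        ((f \o u)%VF : cochain M L (0 + q)%N) \in coboundaries M L (0 + q)%N].
  case: q g g' gg' {phi phi' phiA phi0 phid phiA' phi0' phid'} => [|q'] g g'.
    move/coboundaries0P->; exists 0; split; rewrite ?comp_lfun0l ?comp_lfun0r ?mem0v //.
    by move=> h hA; rewrite comp_lfun0r mem0v.
  case/coboundariesSP=> h hA ->.
  have [s sA hE] := @res_proj _ _ _ (std_res M) q' _ _ _ _
    (res_augA (std_res N)) (res_onto (std_res N)) hA.
  exists (s \o res_d (std_res M) q')%VF; split.
  - exact: homA_comp sA (res_dA _ _).
  - by rewrite -comp_lfunA res_dd comp_lfun0r.
  - by rewrite comp_lfunA hE.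
  - move=> f' fA'; apply/coboundariesSP; exists (f' \o s)%VF; first exact: homA_comp.
    by rewrite comp_lfunA.
have [|||||||||t [tA t0 tS]] := @comparison_homotopy _ _
  (fun i => std_res M (i + q)%N) (fun i => res_d (std_res M) (i + q)%N) _ _ _
  _ (res_d (std_res N)) _ (res_aug (std_res N)) _ (fun i => phi i - phi' i) u.
- by move=> i; exact: res_proj.
- by move=> i; exact: res_dA.
- by move=> i; exact: res_dd.
- exact: res_exact_augmented.
- by move=> i; exact: memvB (phiA i) (phiA' i).
- exact: uA.
- by move=> i; rewrite comp_lfunDr comp_lfunNr phid phid' comp_lfunDl comp_lfunNl.
- by rewrite comp_lfunDr comp_lfunNr phi0 phi0' eu.
- exact: ud.
rewrite -comp_lfunNr -comp_lfunDr.
(* What remains is [f \o u] when [p = 0], and otherwise [f \o t p'] after a differential. *)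
case: p f fA fd => [|p'] f fA fd.
  by rewrite t0 comp_lfunDr (comp_lfunA f) fd comp_lfun0l addr0 fu.
rewrite tS comp_lfunDr 2!(comp_lfunA f) fd comp_lfun0l addr0.
by apply/coboundariesSP; exists (f \o t p')%VF; first exact: homA_comp.
Qed.

End Lifting.

(** Representatives and liftings exist, so the set inside [yoneda] is inhabited and the default
    value of [xget] never arises. *)
Lemma yonedaP M N L p q (x : ext N L p) (y : ext M N q) :
  exists f g phi, [/\ represents f x, represents g y, @lifting _ _ M N q g phi &
    yoneda x y = cls ((f \o phi p)%VF : cochain M L (p + q)%N)].
Proof.
have [[f fx] [g gy]] := (represents_exists x, represents_exists y).
have [phi gphi] := lifting_exists gy.1.
rewrite /yoneda; case: xgetP => [z _ [f' [g' [phi' []]]]|none]; first by exists f', g', phi'.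
by case: (none (cls ((f \o phi p)%VF : cochain M L (p + q)%N))); exists f, g, phi.
Qed.

Lemma yoneda0l M N L p q (y : ext M N q) : yoneda (0 : ext N L p) y = 0.
Proof.
have [f [g [phi [/represents0P fB gy gphi ->]]]] := yonedaP (0 : ext N L p) y.
exact/cls_coboundary/lifting_comp_coboundary/fB/gphi.
Qed.

(** Any lifting of a coboundary can be compared with the zero lifting of the zero cocycle. *)
Lemma yoneda0r M N L p q (x : ext N L p) : yoneda x (0 : ext M N q) = 0.
Proof.
have [f [g [phi [fx /represents0P gB gphi ->]]]] := yonedaP x (0 : ext M N q).
have lift0 : @lifting _ _ M N q 0 (fun=> 0).
  by split=> [i||i]; rewrite ?comp_lfun0l ?comp_lfun0r ?mem0v.
have := lifting_comp_unique gphi lift0 _ fx.1.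
by rewrite comp_lfun0r !subr0 => /(_ gB); exact: cls_coboundary.
Qed.

(** The identity across propositionally equal degrees. As [i + 0] is not convertible to [i], the
    identity chain map becomes a lifting with [q = 0] only through this cast. *)
Definition res_cast M m n (e : m = n) : 'Hom(std_res M m, std_res M n) :=
  ecast i 'Hom(std_res M m, std_res M i) e \1%VF.

Lemma res_castA M m n (e : m = n) : res_cast M e \in homA (std_res M m) (std_res M n).
Proof. by case: n / e; exact: homA_id. Qed.

Lemma res_cast_d M m n (e : m = n) (e' : m.+1 = n.+1) :
  (res_d (std_res M) n \o res_cast M e')%VF = (res_cast M e \o res_d (std_res M) m)%VF.
Proof.
by case: n / e e' => e'; rewrite (eq_irrelevance e' erefl) /= comp_lfun1l comp_lfun1r.
Qed.

Lemma res_cast_lifting M :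
  @lifting _ _ M M 0 (res_aug (std_res M)) (fun i => res_cast M (addn0 i)).
Proof.
split=> [i||i]; last exact: res_cast_d.
  exact: res_castA.
by rewrite (eq_irrelevance (addn0 0) erefl) comp_lfun1r.
Qed.

Lemma res_cast_coboundary M L m n (e : m = n) (f : cochain M L n) :
  ((f \o res_cast M e)%VF : cochain M L m) \in coboundaries M L m ->
  f \in coboundaries M L n.
Proof. by case: n / e f => f; rewrite comp_lfun1r. Qed.

(** The augmentation represents the identity in degree 0, and the identity chain map lifts it.
    Composing with it therefore returns [x], up to a cast of degrees. *)
Lemma yoneda_id_eq0 M L p (x : ext M L p) :
  yoneda x (cls (res_aug (std_res M) : cochain M M 0)) = 0 -> x = 0.
Proof.
have [f [g [phi [fx [gZ gE] gphi ->]]]] := yonedaP x (cls (res_aug (std_res M) : cochain M M 0)).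
have gB := (cls_eqP gZ (aug_cocycle M)).1 gE.
have fphi := lifting_comp_unique gphi (res_cast_lifting M) gB fx.1.
move=> /(cls_eq0P (lifting_comp_cocycle gphi fx.1)).1 fB.
have /res_cast_coboundary/represents0P[_ f0] : ((f \o res_cast M (addn0 p))%VF
    : cochain M L (p + 0)%N) \in coboundaries M L (p + 0)%N.
  by have := memvB fB fphi; rewrite opprB addrC subrK.
by case: fx => _ <-.
Qed.

End ExtClasses.

(** * Tensor products of modules *)

Lemma lin_comp (k : fieldType) (U V W : vectType k) (f : V -> W) (g : U -> V) :
  linear f -> linear g -> linear (fun x => f (g x)).
Proof. by move=> lf lg c x y; rewrite lg lf. Qed.

Lemma lfun_lin (k : fieldType) (U V : vectType k) (f : 'Hom(U, V)) : linear f.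
Proof. exact: linearP. Qed.

Section TensorFunctor.
Variables (k : fieldType) (A : hopfAlg k).
Implicit Types L M N X : amod A.

Lemma lfun_tens_eq M N L (f g : 'Hom(amod_tens M N, L)) :
  (forall x y, f (x \ot y) = g (x \ot y)) -> f = g.
Proof. by move=> E; apply/lfunP; apply: tens_eq E; exact: lfun_lin. Qed.

Lemma tensrE M M' N (f : 'Hom(M, M')) t : tensr N f t = tmap f id t.
Proof. by rewrite linfunP //; exact: tlift_linear. Qed.

Lemma tensr_pure M M' N (f : 'Hom(M, M')) x (y : N) :
  tensr N f (x \ot y) = f x \ot y :> tens M' N.
Proof. by rewrite tensrE tmap_pure //; exact: lfun_lin. Qed.

Lemma tensr_id M N : tensr N (\1%VF : 'Hom(M, M)) = \1%VF.
Proof. by apply: lfun_tens_eq => x y; rewrite tensr_pure !id_lfunE. Qed.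

Lemma tensr_comp M M' M'' N (f : 'Hom(M', M'')) (g : 'Hom(M, M')) :
  tensr N (f \o g)%VF = (tensr N f \o tensr N g)%VF.
Proof.
by apply: lfun_tens_eq => x y; rewrite comp_lfunE tensr_pure comp_lfunE tensr_pure tensr_pure.
Qed.

Lemma tensr_lin M M' N : linear (@tensr k A M M' N).
Proof.
move=> c f g; apply: lfun_tens_eq => x y.
by rewrite add_lfunE scale_lfunE !tensr_pure add_lfunE scale_lfunE (tensv_bilin M' N).1.
Qed.

(** Letting [s] range over all of A (x) A, instead of coproducts only, allows a check on pure
    tensors. *)
Lemma tact_tensr M M' N (f : 'Hom(M, M')) s t :
  f \in homA M M' -> tact s (tensr N f t) = tensr N f (tact s t) :> tens M' N.
Proof.
move=> /homAP fA.
apply: (tens_eq (f := fun s => tact s (tensr N f t) : tens M' N)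
                (g := fun s => tensr N f (tact s t) : tens M' N)).
- exact: (tact_bilin _ _).1.
- by apply: lin_comp; [exact: lfun_lin | exact: (tact_bilin _ _).1].
move=> a b; apply: (tens_eq (f := fun t => tact (a \ot b) (tensr N f t) : tens M' N)
                (g := fun t => tensr N f (tact (a \ot b) t) : tens M' N)) t.
- by apply: lin_comp; [exact: (tact_bilin _ _).2 | exact: lfun_lin].
- by apply: lin_comp; [exact: lfun_lin | exact: (tact_bilin _ _).2].
by move=> x y; rewrite tact_pure !tensr_pure tact_pure fA.
Qed.

Lemma tensrA M M' N (f : 'Hom(M, M')) :
  f \in homA M M' -> tensr N f \in homA (amod_tens M N) (amod_tens M' N).
Proof. by move=> fA; apply/homAP => a t; rewrite /= /tens_act tact_tensr. Qed.

Lemma unitl_pure N (c : k^o) (x : N) : unitl N (c \ot x) = c *: x.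
Proof.
have lb : bilin (fun (c : k^o) (x : N) => c *: x).
  split=> [y a b d|a b y z]; first by rewrite scalerDl -scalerA.
  by rewrite scalerDr !scalerA mulrC.
by rewrite linfunP ?tlift_pure //; exact: tlift_linear.
Qed.

Lemma unitlA N : unitl N \in homA (amod_tens (triv A) N) N.
Proof.
apply/homAP => a t.
(* The coproduct of [a] is replaced by an arbitrary [s], so that both sides are linear in [s]. The
   left counit law then recovers [a]. *)
suff E s : unitl N (tact s t) = act (tlift (fun x y => counit A x *: y) s) (unitl N t).
  by rewrite [LHS]E counitl.
have [Nl Nr] := act_bilin N.
apply: (@tens_eq k A A N (fun s => unitl N (tact s t))
  (fun s => act (tlift (fun x y => counit A x *: y) s) (unitl N t))).
- exact: (@lin_comp _ _ (amod_tens (triv A) N) _ (unitl N) (fun s => tact s t)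
    (lfun_lin _) ((tact_bilin _ _).1 _)).
- exact: (lin_comp (Nl _) (@tlift_linear k A A A _)).
have lb : bilin (fun x y : A => counit A x *: y).
  split=> [y c u v|x c u v]; first by rewrite linearP scalerDl -scalerA.
  by rewrite scalerDr !scalerA mulrC.
move=> u v; rewrite (tlift_pure _ _ lb).
apply: (@tens_eq k (triv A) N N (fun t => unitl N (tact (u \ot v) t))
  (fun t => act (counit A u *: v) (unitl N t))) t.
- by apply: lin_comp; [exact: lfun_lin | exact: (tact_bilin _ _).2].
- by apply: lin_comp; [exact: Nr | exact: lfun_lin].
move=> c x; rewrite tact_pure !unitl_pure (linZ (Nl _)) (linZ (Nr _)) scalerA.
by rewrite /= /triv_act.
Qed.

Lemma unitl_inj N : injective (unitl N).
Proof.
apply: (can_inj (g := fun x => (1 : k^o) \ot x : amod_tens (triv A) N)).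
have [Tl Tr] := tensv_bilin k^o N.
apply: (tens_eq (f := fun t => (1 : k^o) \ot unitl N t) (g := id)) => //.
  by apply: lin_comp; [exact: Tr | exact: lfun_lin].
move=> c x; rewrite unitl_pure (linZ (Tr _)) -(linZ (Tl _)).
by rewrite /GRing.scale /= mulr1.
Qed.

Lemma limg_tensr M M' N (f : 'Hom(M, M')) : limg f = fullv -> limg (tensr N f) = fullv.
Proof.
move=> f_onto; apply/vspaceP => t; rewrite memvf.
have -> : t = tensr N f (tensr N (f^-1)%VF t).
  rewrite -comp_lfunE -tensr_comp.
  have -> : (f \o f^-1)%VF = \1%VF.
    by apply/lfunP => x; rewrite comp_lfunE id_lfunE limg_lfunVK // f_onto memvf.
  by rewrite tensr_id id_lfunE.
exact/memv_img/memvf.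
Qed.

(** The splitting maps [s] and [r] need not be A-linear. [tensr] is functorial and additive on all
    linear maps, so the splitting identity can be tensored with [N]. *)
Lemma tensr_exact L M M' N (f : 'Hom(L, M)) (g : 'Hom(M, M')) :
  limg f = lker g -> limg (tensr N f) = lker (tensr N g).
Proof.
move=> ex; apply/eqP; rewrite eqEsubv; apply/andP; split.
  apply/subvP => t /memv_imgP[u _ ->].
  rewrite memv_ker -comp_lfunE -tensr_comp (limg_lker_comp0 ex).
  by rewrite (lin0 (@tensr_lin _ _ _)) lfunE.
have [s [r E]] := @linear_retract _ _ _ _ f g ltac:(by rewrite ex).
apply/subvP => t; rewrite memv_ker => /eqP gt0.
have -> : t = tensr N f (tensr N s t).
  rewrite -[LHS]id_lfunE -tensr_id.
  have -> : \1%VF = ((f \o s) + (r \o g))%VF.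
    by apply/lfunP => x; rewrite id_lfunE add_lfunE !comp_lfunE -E.
  by rewrite (linD (@tensr_lin _ _ _)) add_lfunE !tensr_comp !comp_lfunE gt0 linear0 addr0.
exact/memv_img/memvf.
Qed.

Lemma tensr_exact_augmented (D : nat -> amod A) d (Y : amod A) (e : 'Hom(D 0, Y)) N :
  exact_augmented d e ->
  exact_augmented (D := fun i => amod_tens (D i) N) (fun i => tensr N (d i)) (tensr N e).
Proof.
move=> [dA eA e_onto ex0 ex]; split=> [i|||| i].
- exact: tensrA.
- exact: tensrA.
- exact: limg_tensr.
- exact: tensr_exact.
- exact: tensr_exact.
Qed.

(** This is the target complex of [tens_lifting]: the resolution of k tensored with [N], augmented
    to [N] through the bijection [unitl N]. *)
Lemma tens_triv_exact_augmented N :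
  exact_augmented (D := fun i => amod_tens (std_res (triv A) i) N)
    (fun i => tensr N (res_d (std_res (triv A)) i))
    (unitl N \o tensr N (res_aug (std_res (triv A))))%VF.
Proof.
have [dA eA e_onto ex0 ex] :=
  tensr_exact_augmented N (res_exact_augmented (std_res (triv A))).
split=> //.
- exact: homA_comp (unitlA N) eA.
- apply/vspaceP => x; rewrite memvf.
  have -> : x = unitl N ((1 : k^o) \ot x : amod_tens (triv A) N).
    by rewrite unitl_pure scale1r.
  rewrite limg_comp e_onto; exact/memv_img/memvf.
- rewrite ex0; apply/vspaceP => t.
  rewrite !memv_ker comp_lfunE; apply/eqP/eqP => [->|E]; first exact: linear0.
  by apply: (@unitl_inj N); rewrite E linear0.
Qed.

End TensorFunctor.

(** * Associativity and braiding of tensor products *)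

Section LinearTensor.
Variables (k : fieldType) (U V W : vectType k).

Lemma tassoc_pure (u : U) (v : V) (w : W) : tassoc ((u \ot v) \ot w) = u \ot (v \ot w).
Proof.
have [UVl UVr] := tensv_bilin U (tens V W); have [VWl VWr] := tensv_bilin V W.
rewrite /tassoc !tlift_pure //; split=> [y|x].
- exact: UVl.
- by move=> c a b; rewrite VWl UVr.
- exact: tlift_linear.
apply: (@tlift_lin_param k U V _ W (fun w u v => u \ot (v \ot w))) => a b c y z.
by rewrite VWr UVr.
Qed.

Lemma tflip_pure (u : U) (v : V) : tflip (u \ot v) = v \ot u.
Proof.
have [Tl Tr] := tensv_bilin V U.
by rewrite /tflip tlift_pure.
Qed.

End LinearTensor.

Lemma tflipK (k : fieldType) (U V : vectType k) : cancel (@tflip k U V) (@tflip k V U).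
Proof.
apply: (tens_eq (f := fun t => tflip (tflip t)) (g := id)) => //.
  by apply: lin_comp; exact: tlift_linear.
by move=> u v; rewrite !tflip_pure.
Qed.

Section TensorModules.
Variables (k : fieldType) (A : hopfAlg k).
Implicit Types L M N X : amod A.

Definition tensl L M N (f : 'Hom(M, N)) : 'Hom(amod_tens L M, amod_tens L N) :=
  linfun (tmap (id : L -> L) f : amod_tens L M -> amod_tens L N).

Lemma tensl_pure L M N (f : 'Hom(M, N)) (x : L) y :
  tensl L f (x \ot y) = x \ot f y :> tens L N.
Proof. by rewrite linfunP ?tmap_pure //; [exact: lfun_lin | exact: tlift_linear]. Qed.

Lemma tenslA L M N (f : 'Hom(M, N)) :
  f \in homA M N -> tensl L f \in homA (amod_tens L M) (amod_tens L N).
Proof.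
move=> /homAP fA; apply/homAP => a t; rewrite /= /tens_act.
apply: (tens_eq (f := fun s => tensl L f (tact s t) : tens L N)
                (g := fun s => tact s (tensl L f t) : tens L N)).
- by apply: lin_comp; [exact: lfun_lin | exact: (tact_bilin _ _).1].
- exact: (tact_bilin _ _).1.
move=> b c; apply: (tens_eq (f := fun t => tensl L f (tact (b \ot c) t) : tens L N)
                (g := fun t => tact (b \ot c) (tensl L f t) : tens L N)) t.
- by apply: lin_comp; [exact: lfun_lin | exact: (tact_bilin _ _).2].
- by apply: lin_comp; [exact: (tact_bilin _ _).2 | exact: lfun_lin].
by move=> x y; rewrite tact_pure !tensl_pure tact_pure fA.
Qed.

Definition tens_assoc L M N :
    'Hom(amod_tens (amod_tens L M) N, amod_tens L (amod_tens M N)) :=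
  linfun (@tassoc k L M N : amod_tens (amod_tens L M) N -> amod_tens L (amod_tens M N)).

Lemma tens_assocE L M N t : tens_assoc L M N t = tassoc t.
Proof. by rewrite linfunP //; exact: tlift_linear. Qed.

Lemma tens_assoc_pure L M N (x : L) (y : M) (z : N) :
  tens_assoc L M N ((x \ot y : tens L M) \ot z) = x \ot (y \ot z : tens M N).
Proof. by rewrite tens_assocE tassoc_pure. Qed.

Lemma lfun_tens3_eq L M N X (f g : 'Hom(amod_tens (amod_tens L M) N, X)) :
  (forall x y z, f ((x \ot y : tens L M) \ot z) = g ((x \ot y : tens L M) \ot z)) -> f = g.
Proof.
move=> E; apply: lfun_tens_eq => t z.
have [Tl _] := tensv_bilin (tens L M) N.
apply: (@tens_eq k L M X (fun t => f (t \ot z)) (fun t => g (t \ot z)))  => //.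
- exact: (lin_comp (lfun_lin f) (Tl z)).
- exact: (lin_comp (lfun_lin g) (Tl z)).
Qed.

(* On pure tensors both sides are the action of a twofold coproduct of [a] on *)
(* [x \ot (y \ot z)], so that coassociativity identifies them.                *)
Lemma tens_assocA L M N :
  tens_assoc L M N \in homA (amod_tens (amod_tens L M) N) (amod_tens L (amod_tens M N)).
Proof.
apply/homAP => a t.
pose ac X : 'Hom(X, X) := linfun (@act k A X a).
have acE X x : ac X x = act a x by rewrite linfunP //; exact: (act_bilin X).2.
rewrite -!acE -!comp_lfunE; congr (fun_of_lfun _ t).
apply: lfun_tens3_eq => x y z; rewrite !comp_lfunE tens_assoc_pure !acE /= /tens_act.
(* The action of A (x) (A (x) A) on the fixed vector [x \ot (y \ot z)]. [E1] and [E2] write the two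
   sides through [T3], at the two bracketings of the iterated coproduct. *)
pose T3 (u : tens A (tens A A)) : tens L (tens M N) :=
  tlift (fun b w => act b x \ot tact w (y \ot z)) u.
have [Tl Tr] := tensv_bilin L (tens M N).
have T3_pure b w : T3 (b \ot w) = act b x \ot tact w (y \ot z).
  rewrite /T3 tlift_pure //; split=> [w'|b'].
    exact: (lin_comp (Tl _) ((act_bilin L).1 x)).
  exact: (lin_comp (Tr _) ((tact_bilin M N).1 _)).
have T3_lin : linear T3 by exact: tlift_linear.
have lcomul : linear (comul A) by exact: lfun_lin.
have [AAl _] := tensv_bilin (tens A A) A.
have [LMl _] := tensv_bilin (tens L M) N.
have E1 s : tens_assoc L M N (tact s ((x \ot y : amod_tens L M) \ot z)) =
    T3 (tassoc (tmap (comul A) id s)).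
  apply: (@tens_eq k A A (tens L (tens M N))
    (fun s => tens_assoc L M N (tact s ((x \ot y : amod_tens L M) \ot z)))
    (fun s => T3 (tassoc (tmap (comul A) id s)))).
  - exact: (lin_comp (lfun_lin (tens_assoc L M N)) ((tact_bilin (amod_tens L M) N).1 _)).
  - exact: (lin_comp T3_lin (lin_comp (@tlift_linear _ _ _ _ _) (@tlift_linear _ _ _ _ _))).
  move=> b c; rewrite tact_pure tmap_pure //= /tens_act.
  apply: (@tens_eq k A A (tens L (tens M N))
    (fun s => tens_assoc L M N ((tact s (x \ot y) : tens L M) \ot act c z))
    (fun s => T3 (tassoc (s \ot c)))).
  - exact: (lin_comp (lfun_lin (tens_assoc L M N))
      (lin_comp (LMl _) ((tact_bilin L M).1 _))).
  - exact: (lin_comp T3_lin (lin_comp (@tlift_linear _ _ _ _ _) (AAl _))).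
  by move=> d e; rewrite tact_pure tens_assoc_pure tassoc_pure T3_pure tact_pure.
have E2 s : tact s (x \ot (y \ot z : amod_tens M N)) = T3 (tmap id (comul A) s).
  apply: (@tens_eq k A A (tens L (tens M N))
    (fun s => tact s (x \ot (y \ot z : amod_tens M N)))
    (fun s => T3 (tmap id (comul A) s))).
  - exact: (tact_bilin L (amod_tens M N)).1.
  - exact: (lin_comp T3_lin (@tlift_linear _ _ _ _ _)).
  by move=> b c; rewrite tact_pure tmap_pure // T3_pure.
by rewrite E1 coassoc -E2.
Qed.

Lemma tact_tflip M N s t : tact (tflip s) (tflip t) = tflip (tact s t) :> tens N M.
Proof.
apply: (@tens_eq k A A (tens N M) (fun s => tact (tflip s) (tflip t))
  (fun s => tflip (tact s t))).
- exact: (lin_comp ((tact_bilin N M).1 _) (@tlift_linear _ _ _ _ _)).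
- exact: (lin_comp (@tlift_linear _ _ _ _ _) ((tact_bilin M N).1 _)).
move=> b c; apply: (@tens_eq k M N (tens N M)
  (fun t => tact (tflip (b \ot c)) (tflip t)) (fun t => tflip (tact (b \ot c) t))) t.
- exact: (lin_comp ((tact_bilin N M).2 _) (@tlift_linear _ _ _ _ _)).
- exact: (lin_comp (@tlift_linear _ _ _ _ _) ((tact_bilin M N).2 _)).
by move=> x y; rewrite !tact_pure !tflip_pure tact_pure.
Qed.

Lemma tact11 M N (t : tens M N) : tact ((1 : A) \ot (1 : A)) t = t.
Proof. by rewrite -comul1; exact: tens_act1. Qed.

(** The braiding acts by [R] and then flips. It is A-linear since [R] intertwines the coproduct with
    its opposite, and it is undone by flipping back and acting by the inverse of [R]. *)
Lemma quasitriangular_braiding M N : quasitriangular A ->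
  exists (i : 'Hom(amod_tens M N, amod_tens N M)) (r : 'Hom(amod_tens N M, amod_tens M N)),
    [/\ i \in homA (amod_tens M N) (amod_tens N M),
        r \in homA (amod_tens N M) (amod_tens M N) & (r \o i)%VF = \1%VF].
Proof.
move=> [R [[R' [RR' R'R]] Rcomul _ _]].
pose i : 'Hom(amod_tens M N, amod_tens N M) :=
  linfun ((fun t => tflip (tact R t)) : amod_tens M N -> amod_tens N M).
pose r : 'Hom(amod_tens N M, amod_tens M N) :=
  linfun ((fun t => tact R' (tflip t)) : amod_tens N M -> amod_tens M N).
have iE t : i t = tflip (tact R t).
  rewrite linfunP //; exact: (lin_comp (@tlift_linear _ _ _ _ _) ((tact_bilin M N).2 _)).
have rE t : r t = tact R' (tflip t).
  rewrite linfunP //; exact: (lin_comp ((tact_bilin M N).2 _) (@tlift_linear _ _ _ _ _)).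
have ri t : r (i t) = t by rewrite rE iE tflipK -tactM R'R tact11.
have ir t : i (r t) = t by rewrite iE rE -tactM RR' tact11 tflipK.
have iA a t : i (act a t) = act a (i t).
  rewrite !iE /= /tens_act -tactM -Rcomul tactM -{2}[comul A a]tflipK.
  by rewrite tact_tflip.
exists i, r; split.
- exact/homAP.
(* A two-sided inverse of an A-linear map is A-linear. *)
- by apply/homAP => a t; rewrite -{1}[t]ir -iA ri.
- by apply/lfunP => t; rewrite comp_lfunE ri id_lfunE.
Qed.

End TensorModules.

(** * The action of - (x) N on cohomology *)

Section TensorAction.
Variables (k : fieldType) (A : hopfAlg k).
Implicit Types L M N X : amod A.
Local Notation P := (std_res (triv A)).

(** Sends [x \ot y] to [f x *: y]. For a cocycle [f] on the resolution of k, this is [f] tensored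
    with [N] before transport along a [tens_lifting]. *)
Definition contract M N (f : 'Hom(M, triv A)) : 'Hom(amod_tens M N, N) :=
  (unitl N \o tensr N f)%VF.

Lemma contractA M N (f : 'Hom(M, triv A)) :
  f \in homA M (triv A) -> contract N f \in homA (amod_tens M N) N.
Proof. by move=> fA; exact: homA_comp (unitlA N) (tensrA N fA). Qed.

Lemma contract_lin M N : linear (@contract M N).
Proof.
by move=> c f g; rewrite /contract (@tensr_lin _ _ _ _ N) comp_lfunDr comp_lfunZr.
Qed.

Lemma contractB M N (f g : 'Hom(M, triv A)) :
  contract N (f - g) = contract N f - contract N g.
Proof. by rewrite addrC -scaleN1r contract_lin scaleN1r addrC. Qed.

Lemma contract_pure M N (f : 'Hom(M, triv A)) x (y : N) :
  contract N f (x \ot y) = f x *: y.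
Proof. by rewrite /contract comp_lfunE tensr_pure unitl_pure. Qed.

Lemma contract_comp L M N (f : 'Hom(M, triv A)) (g : 'Hom(L, M)) :
  contract N (f \o g)%VF = (contract N f \o tensr N g)%VF.
Proof. by rewrite /contract tensr_comp comp_lfunA. Qed.

Lemma tensr_tensl L M N X (f : 'Hom(L, M)) (g : 'Hom(N, X)) :
  (tensr X f \o tensl L g)%VF = (tensl M g \o tensr N f)%VF.
Proof.
apply: lfun_tens_eq => x y; rewrite !comp_lfunE.
by rewrite tensl_pure tensr_pure tensr_pure tensl_pure.
Qed.

Lemma contract_tensl L M N (f : 'Hom(L, triv A)) (g : 'Hom(M, N)) :
  (contract N f \o tensl L g)%VF = (g \o contract M f)%VF.
Proof.
apply: lfun_tens_eq => x y; rewrite [LHS]comp_lfunE [RHS]comp_lfunE.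
by rewrite tensl_pure !contract_pure linearZ.
Qed.

Lemma tensr_assoc L L' M N (f : 'Hom(L, L')) :
  (tensr (amod_tens M N) f \o tens_assoc L M N)%VF =
  (tens_assoc L' M N \o tensr N (tensr M f))%VF.
Proof.
apply: lfun_tens3_eq => x y z; rewrite !comp_lfunE.
by rewrite tens_assoc_pure !tensr_pure tens_assoc_pure.
Qed.

Lemma contract_assoc L M N (f : 'Hom(L, triv A)) :
  (contract (amod_tens M N) f \o tens_assoc L M N)%VF = tensr N (contract M f).
Proof.
apply: lfun_tens3_eq => x y z; rewrite [LHS]comp_lfunE.
rewrite tens_assoc_pure tensr_pure !contract_pure.
by rewrite (linZ ((tensv_bilin M N).1 z)).
Qed.

Lemma tens_lifting_exists N : exists psi, @tens_lifting _ _ N psi.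
Proof.
have [|||psi [psiA psi0 psid]] := comparison_exists (C := fun i => std_res N i)
  (dC := res_d (std_res N)) _ _ _ (tens_triv_exact_augmented N)
  (res_augA (std_res N)) (res_aug_d (std_res N)).
- by move=> i; exact: res_proj.
- exact: res_dA.
- exact: res_dd.
by exists psi.
Qed.

Lemma tens_lifting_comp_cocycle N psi n (f : cochain (triv A) (triv A) n) :
  @tens_lifting _ _ N psi -> f \in cocycles (triv A) (triv A) n ->
  ((contract N f \o psi n)%VF : cochain N N n) \in cocycles N N n.
Proof.
move=> [psiA _ psid] /cocyclesP[fA fd]; apply/cocyclesP; split.
  exact: homA_comp (contractA N fA) (psiA n).
rewrite -comp_lfunA -psid comp_lfunA -contract_comp fd.
by rewrite (lin0 (@contract_lin _ _)) comp_lfun0l.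
Qed.

Lemma tens_lifting_comp_coboundary N psi n (f : cochain (triv A) (triv A) n) :
  @tens_lifting _ _ N psi -> f \in coboundaries (triv A) (triv A) n ->
  ((contract N f \o psi n)%VF : cochain N N n) \in coboundaries N N n.
Proof.
move=> [psiA _ psid]; case: n f => [|n] f.
  by move/coboundaries0P->; rewrite (lin0 (@contract_lin _ _)) comp_lfun0l mem0v.
case/coboundariesSP=> g gA ->; apply/coboundariesSP.
exists (contract N g \o psi n)%VF; first exact: homA_comp (contractA N gA) (psiA n).
by rewrite contract_comp -comp_lfunA psid comp_lfunA.
Qed.

(** Both liftings cover the identity of [N], so their difference is null-homotopic with correction
    0. The tensored cocycle kills the part of the homotopy formula that begins with a
    differential. *)
Lemma tens_lifting_comp_unique N psi psi' n (f : cochain (triv A) (triv A) n) :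
  @tens_lifting _ _ N psi -> @tens_lifting _ _ N psi' ->
  f \in cocycles (triv A) (triv A) n ->
  ((contract N f \o psi n)%VF - (contract N f \o psi' n)%VF : cochain N N n)
    \in coboundaries N N n.
Proof.
move=> [psiA psi0 psid] [psiA' psi0' psid'] /cocyclesP[fA fd].
have [||||||||t [tA t0 tS]] := @comparison_homotopy _ _
  (fun i => std_res N i) (res_d (std_res N)) _ _ _ _ _ _ _
  (tens_triv_exact_augmented N) (fun i => psi i - psi' i) 0.
- by move=> i; exact: res_proj.
- exact: res_dA.
- exact: res_dd.
- by move=> i; exact: memvB (psiA i) (psiA' i).
- exact: mem0v.
- by move=> i; rewrite comp_lfunDr comp_lfunNr psid psid' comp_lfunDl comp_lfunNl.
- by rewrite comp_lfunDr comp_lfunNr psi0 psi0' subrr comp_lfun0r.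
- exact: comp_lfun0l.
have fd0 : (contract N f \o tensr N (res_d P n))%VF = 0.
  by rewrite -contract_comp fd (lin0 (@contract_lin _ _)).
rewrite -comp_lfunNr -comp_lfunDr.
case: n f fA fd fd0 => [|n] f fA fd fd0.
  by rewrite t0 add0r comp_lfunA fd0 comp_lfun0l mem0v.
rewrite tS comp_lfunDr 2!(comp_lfunA (contract N f)) fd0 comp_lfun0l addr0.
apply/coboundariesSP; exists (contract N f \o t n)%VF => //.
exact: homA_comp (contractA N fA) (tA n).
Qed.

Lemma ext_tensrP N n (z : ext (triv A) (triv A) n) :
  exists f psi, [/\ represents f z, @tens_lifting _ _ N psi &
    ext_tensr N z = cls ((contract N f \o psi n)%VF : cochain N N n)].
Proof.
have [[f fz] [psi psiL]] := (represents_exists z, tens_lifting_exists N).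
rewrite /ext_tensr; case: xgetP => [w _ [f' [psi' []]]|none]; first by exists f', psi'.
case: (none (cls ((contract N f \o psi n)%VF : cochain N N n))).
by exists f, psi.
Qed.

(* Up to homotopy, the lifting for X factors through the lifting for M,      *)
(* tensored with N.                                                          *)
Lemma ext_tensr_retract M N X (i : 'Hom(X, amod_tens M N)) (r : 'Hom(amod_tens M N, X))
    n (z : ext (triv A) (triv A) n) :
  i \in homA X (amod_tens M N) -> r \in homA (amod_tens M N) X -> (r \o i)%VF = \1%VF ->
  ext_tensr M z = 0 -> ext_tensr X z = 0.
Proof.
move=> iA rA ri; have [f0 [psi0 [f0z psi0L ->]]] := ext_tensrP M z.
move=> /(cls_eq0P (tens_lifting_comp_cocycle psi0L f0z.1)).1 f0B.
have [f [psi [fz psiL ->]]] := ext_tensrP X z.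
(* [theta] covers [i], going from the resolution of [X] to the resolution of [M] tensored with [N],
   which is exact over M (x) N. *)
have [|||||theta [thetaA theta0 thetad]] := comparison_exists
  (C := fun j => std_res X j) (dC := res_d (std_res X)) (g := (i \o res_aug (std_res X))%VF)
  _ _ _ (tensr_exact_augmented N (res_exact_augmented (std_res M))).
- by move=> j; exact: res_proj.
- exact: res_dA.
- exact: res_dd.
- exact: homA_comp iA (res_augA _).
- by rewrite -comp_lfunA res_aug_d comp_lfun0r.
have [psi0A psi00 psi0d] := psi0L.
(* Tensor the lifting for [M] with [N], reassociate, and apply [r] to the factor M (x) N. *)
pose alpha j : 'Hom(amod_tens (std_res M j) N, amod_tens (P j) X) :=
  (tensl (P j) r \o (tens_assoc (P j) M N \o tensr N (psi0 j)))%VF.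
have contract_alpha j (h : 'Hom(P j, triv A)) :
    (contract X h \o alpha j)%VF = (r \o tensr N (contract M h \o psi0 j))%VF.
  by rewrite /alpha comp_lfunA contract_tensl -comp_lfunA (comp_lfunA (contract _ _))
             contract_assoc tensr_comp.
have alphad j : (tensr X (res_d P j) \o alpha j.+1)%VF =
                (alpha j \o tensr N (res_d (std_res M) j))%VF.
  rewrite /alpha comp_lfunA tensr_tensl -comp_lfunA (comp_lfunA (tensr _ _)) tensr_assoc.
  by rewrite -!comp_lfunA -!tensr_comp psi0d.
pose omega j := (alpha j \o theta j)%VF.
have omegaL : @tens_lifting _ _ X omega.
  split=> [j||j].
  - apply: homA_comp (thetaA j); apply: homA_comp (tenslA _ rA) _.
    exact: homA_comp (tens_assocA _ _ _) (tensrA _ (psi0A j)).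
  (* In degree 0 the composite covers [r \o i], which is the identity of [X]. *)
  - rewrite -/(contract X _) /omega comp_lfunA contract_alpha psi00.
    by rewrite -comp_lfunA theta0 comp_lfunA ri comp_lfun1l.
  - by rewrite /omega comp_lfunA alphad -comp_lfunA thetad comp_lfunA.
apply: cls_coboundary.
(* Three moves modulo coboundaries: [psi] is traded for [omega], then [f] for [f0], and last the
   composite of [f0] with [omega] is shown to be a coboundary. *)
have B1 := tens_lifting_comp_unique psiL omegaL fz.1.
have B2 := tens_lifting_comp_coboundary omegaL (represents_unique fz f0z).
suff B3 : ((contract X f0 \o omega n)%VF : cochain X X n) \in coboundaries X X n.
  have := memvD (memvD B1 B2) B3.
  by rewrite contractB comp_lfunDl comp_lfunNl addrA subrK subrK.
(* The cochain is now [r] after the coboundary [f0B] tensored with [N], composed with the chain map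
   [theta]. A primitive [g] of that coboundary yields the primitive [r \o tensr N g \o theta n]. *)
rewrite /omega comp_lfunA contract_alpha.
clear - f0B rA thetaA thetad.
case: n f0 f0B => [|n] f0.
  by move/coboundaries0P->; rewrite (lin0 (@tensr_lin _ _ _ _ _)) comp_lfun0r comp_lfun0l mem0v.
case/coboundariesSP=> g gA ->; apply/coboundariesSP.
exists (r \o tensr N g \o theta n)%VF.
  exact: homA_comp (homA_comp rA (tensrA N gA)) (thetaA n).
by rewrite tensr_comp -!comp_lfunA thetad.
Qed.

End TensorAction.

(** * Annihilators and support varieties *)

Section Annihilator.
Variables (k : fieldType) (A : hopfAlg k).
Implicit Types M N X : amod A.

Lemma ext_cast_eq0 M N m n (e : m = n) (x : ext M N m) : ext_cast e x = 0 <-> x = 0.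
Proof. by case: n / e. Qed.

Lemma annihilatorP M (h : hprod A) :
  annihilator M h <-> Hev h /\ forall n, ext_tensr M (h n) = 0.
Proof.
split=> [] [hev hM]; split=> //; last first.
  move=> y _ n; rewrite /hact big1 // => i _; apply/ext_cast_eq0; rewrite hM; exact: yoneda0l.
(* The identity class, placed in degree 0. In degree [n] of [hact h y] only the summand of index 0
   survives, and it is the product of [ext_tensr M (h n)] with the identity. *)
pose y : extprod M M := fun n => match n with
  | 0 => cls (res_aug (std_res M) : cochain M M 0)
  | _.+1 => 0 end.
move=> n; have /hM/(_ n) : finite_support y by exists 1%N; case.
rewrite /hact big_ord_recl big1 => [|i _]; last by apply/ext_cast_eq0; exact: yoneda0r.
rewrite addr0 => /ext_cast_eq0/yoneda_id_eq0.
by rewrite /= subn0.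
Qed.

Lemma annihilator_retract M N X (i : 'Hom(X, amod_tens M N)) (r : 'Hom(amod_tens M N, X)) h :
  i \in homA X (amod_tens M N) -> r \in homA (amod_tens M N) X -> (r \o i)%VF = \1%VF ->
  annihilator M h -> annihilator X h.
Proof.
move=> iA rA ri /annihilatorP[hev hM]; apply/annihilatorP; split=> // n.
exact: ext_tensr_retract iA rA ri (hM n).
Qed.

End Annihilator.

Local Open Scope classical_set_scope.

Theorem mainTheorem1 (k : fieldType) (A : hopfAlg k) :
  quasitriangular A ->
  Hev_finitely_generated A ->
  (forall M N : amod A, Ext_finitely_generated M N) ->
  forall M N : amod A,
    support_variety (amod_tens M N) `<=`
      support_variety M `&` support_variety N.
Proof.
move=> qtA _ _ M N m [m_max annm].
have [i [r [iA rA ri]]] := quasitriangular_braiding M N qtA.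
(* It suffices that the annihilators of [M] and of [N] lie in that of M (x) N. For [M] the
   retraction is the identity of M (x) N; for [N] the braiding makes M (x) N a retract of N (x)
   M. *)
split; split=> // h hann; apply: annm.
  exact: annihilator_retract (homA_id _) (homA_id _) (comp_lfun1l _) hann.
exact: annihilator_retract iA rA ri hann.
Qed.
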